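(* There exists an absolute constant $c_1>0$ such that for every irreducible, reversible (discrete-time) Markov chain on a finite state space $V$ with transition matrix $P$ and stationary distribution $\pi$, $$c_1\, t_{\mathrm{rel}} \;\le\; t_{\mathrm{H}}^{\pi} := \max_{A\subsetneq V:\ \pi(A)\ge 1/2} \mathbb{E}_{\pi_{A^c}}[T_A] \;\le\; 2\, t_{\mathrm{rel}}.$$
   Context: State spaces are assumed to have at least two elements. $(X_m)_{m\ge 0}$ denotes the discrete-time Markov chain with transition matrix $P$ on $V$; reversible means $\pi(x)P(x,y)=\pi(y)P(y,x)$ for all $x,y\in V$. The relaxation time is $t_{\mathrm{rel}}:=(1-\beta_2)^{-1}$, where $\beta_2$ is the second largest eigenvalue of $P$ (the eigenvalues of $P$ are real by reversibility; no absolute value is taken). For $A\subseteq V$, $T_A:=\inf\{m\ge 0: X_m\in A\}$ is the hitting time of $A$, $A^c:=V\setminus A$, and for nonempty $D\subseteq V$, $\pi_D$ is the distribution $\pi$ conditioned on $D$, i.e. $\pi_D(x):=\frac{\pi(x)}{\pi(D)}\mathbf{1}\{x\in D\}$. $\mathbb{E}_\mu$ denotes expectation for the chain with initial distribution $\mu$. *)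

(* Defs.v *)
From HB Require Import structures.
From mathcomp Require Import all_boot all_order all_algebra.
From mathcomp Require Import all_classical all_reals all_analysis.

Set Implicit Arguments.
Unset Strict Implicit.
Unset Printing Implicit Defensive.

Import Order.TTheory GRing.Theory Num.Theory.
Local Open Scope classical_set_scope.
Local Open Scope ring_scope.

Section Chain.
Context {R : realType} {V : finType}.
Implicit Types (P : V -> V -> R) (mu pi : V -> R).

Definition is_distr mu : Prop :=
  (forall x, 0 <= mu x) /\ \sum_(x : V) mu x = 1.

Definition transition_matrix P : Prop := forall x, is_distr (P x).

Definition tmx P : 'M[R]_#|V| :=
  \matrix_(i, j) P (enum_val i) (enum_val j).

Definition irreducible P : Prop :=
  forall x y, exists n : nat, 0 < (tmx P ^+ n) (enum_rank x) (enum_rank y).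

Definition stationary P pi : Prop :=
  is_distr pi /\ forall y, \sum_(x : V) pi x * P x y = pi y.

Definition reversible P pi : Prop :=
  forall x y, pi x * P x y = pi y * P y x.

(* The eigenvalues of P, listed with multiplicity in nonincreasing order; such
   a list exists (and is then unique) when the characteristic polynomial splits
   over R, in particular when P is reversible with respect to a positive
   distribution. *)
Definition eigenvalues P : seq R :=
  xget [::] [set s : seq R | sorted >=%R s /\
                             char_poly (tmx P) = \prod_(b <- s) ('X - b%:P)].

Definition beta2 P : R := nth 0 (eigenvalues P) 1.

Definition trel P : R := (1 - beta2 P)^-1.

Definition prob_of mu (A : {set V}) : R := \sum_(x in A) mu x.

Definition conditioned mu (D : {set V}) : V -> R :=
  fun x => if x \in D then mu x / prob_of mu D else 0.

Section Process.
Context {d : measure_display} {Omega : measurableType d}.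
Implicit Types (X : nat -> Omega -> V).

(* The second and third conditions say that X 0 has law mu and that, given
   X 0 = x 0, ..., X n = x n, the next state X n.+1 has law P (x n); the latter
   is written without division, so that null events need no exception. *)
Definition markov_chain P mu (Pr : probability Omega R) X : Prop :=
  [/\ forall n y, measurable [set w | X n w = y],
      forall y, Pr [set w | X 0 w = y] = (mu y)%:E
    & forall (n : nat) (x : nat -> V),
        Pr [set w | forall i, (i <= n.+1)%N -> X i w = x i] =
        (Pr [set w | forall i, (i <= n)%N -> X i w = x i] *
         (P (x n) (x n.+1))%:E)%E].

Definition hitting_time X (A : {set V}) (w : Omega) : \bar R :=
  ereal_inf [set m%:R%:E | m in [set m : nat | X m w \in A]].

(* Pr mu plays the role of the law of the chain started from mu. *)
Definition expected_hitting (Pr : (V -> R) -> probability Omega R) X mu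
    (A : {set V}) : \bar R :=
  \int[Pr mu]_w hitting_time X A w.

Definition tH pi (Pr : (V -> R) -> probability Omega R) X : \bar R :=
  \big[maxe/-oo%E]_(A : {set V} | (A \proper [set: V]%SET) &&
                                  (2^-1 <= prob_of pi A))
    expected_hitting Pr X (conditioned pi (~: A)%SET) A.

End Process.
End Chain.

(* Main.v *)
(* With [E(f, g) = sum_x pi x * f x * (g x - (P g) x)] and [h x] the mean time
   to hit [A] from [x], one has [E(g, h) = pi(g)] for every [g] vanishing on [A],
   and the mean hitting time from [pi] conditioned on [B = ~: A] is
   [pi(h) / pi(B)].
   Upper bound: [Var h <= trel * E(h, h) = trel * pi(h)], while
   [pi(h) ^ 2 <= pi(h ^ 2) * pi(B)] since [h] is supported on [B].
   Lower bound: let [f] be an eigenfunction for [beta2], with sign chosen so that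
   [pi(f > 0) <= 1/2], and let [t] maximize [s * pi((f - s)^+ ^ 2)]. The first-
   and second-order conditions at [t] give, for [g = (f - t)^+],
   [pi(g ^ 2) = 2 * t * pi(g)] and [t * pi(f > t) <= 2 * pi(g)]; moreover
   [E(g, g) <= (1 - beta2) * pi(f * g) = 3 * (1 - beta2) * t * pi(g)]. As
   [pi(g) ^ 2 = E(g, h) ^ 2 <= E(g, g) * pi(h)] for [A = {f <= t}], the mean
   hitting time of [A] is at least [trel / 6]. *)
Require Import Defs.
From mathcomp Require Import all_boot all_order all_algebra.
From mathcomp Require Import sesquilinear spectral complex.
From mathcomp Require Import all_classical all_reals all_analysis.
From mathcomp Require Import measurable_realfun ring lra.

Import Order.TTheory GRing.Theory Num.Theory.
Import numFieldNormedType.Exports.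
Local Open Scope ring_scope.

(** * Spectral theorem for real symmetric matrices *)

(** Taking determinants in [(X - M) U = U (X - N)] leaves a factor [\det U] on both sides, a nonzero
    constant polynomial that cancels. *)
Lemma char_poly_intertwine (F : fieldType) (n : nat) (M N U : 'M[F]_n) :
  U \in unitmx -> M *m U = U *m N -> char_poly M = char_poly N.
Proof.
move=> Uunit MU; have detU : \det (map_mx polyC U) != 0.
  by rewrite det_map_mx polyC_eq0 -unitfE -unitmxE.
apply: (mulIf detU); rewrite /char_poly -det_mulmx mulrC -det_mulmx.
rewrite /char_poly_mx mulmxBl mulmxBr -!map_mxM MU.
by rewrite mul_mx_scalar mul_scalar_mx.
Qed.

(* [A] and [B] are the real and imaginary parts of a unitary diagonalization. *)
Lemma symmetric_spectral (R : rcfType) (n : nat) (S : 'M[R]_n) : S^T = S ->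
  exists (e : 'rV[R]_n) (A B : 'M[R]_n),
    [/\ char_poly S = \prod_i ('X - (e 0 i)%:P),
        A *m S = diag_mx e *m A, B *m S = diag_mx e *m B,
        forall i, \sum_j A i j ^+ 2 + \sum_j B i j ^+ 2 = 1
      & A^T *m A + B^T *m B = 1%:M].
Proof.
move=> symS.
pose rc : {rmorphism R -> R[i]} := real_complex R.
pose Sc : 'M[R[i]]_n := map_mx rc S.
have Sc_real : Sc \is a mxOver Num.real.
  by apply/mxOverP => i j; rewrite mxE; apply/complex_realP; exists (S i j).
have Sc_herm : Sc \is hermsymmx.
  apply: realsym_hermsym => //; apply/is_hermitianmxP.
  rewrite expr0 scale1r; apply/matrixP => i j; rewrite !mxE /=.
  by have /matrixP/(_ i j) := symS; rewrite mxE => ->.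
have Sc_eq := orthomx_spectralP (hermitian_normalmx Sc_herm).
have dreal := hermitian_spectral_diag_real Sc_herm.
have Uunit := spectral_unit Sc.
have Uuni := spectral_unitarymx Sc.
set U := spectralmx Sc in Sc_eq Uunit Uuni *.
set d := spectral_diag Sc in Sc_eq dreal *.
(* Eigenvalues of a Hermitian matrix are real, so [d] descends to a real vector. As [S] is real too,
   the real and imaginary parts of [U S = d U] separate. *)
have [e de] : exists e, d = map_mx rc e.
  exists (map_mx (@complex.Re R) d).
  by apply/rowP => j; rewrite !mxE /= RRe_real //; apply: (mxOverP dreal).
have US : U *m Sc = diag_mx d *m U.
  by rewrite {1}Sc_eq !mulmxA mulmxV // mul1mx.
have UE i k : \sum_j U i j * (S j k)%:C%C = d 0 i * U i k.
  have /matrixP/(_ i k) := US; rewrite mul_diag_mx !mxE => <-.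
  by apply: eq_bigr => j _; rewrite !mxE.
exists e, (map_mx (@complex.Re R) U), (map_mx (@complex.Im R) U); split.
- apply: (@map_poly_inj _ _ rc); rewrite map_char_poly -/Sc.
  have -> : char_poly Sc = char_poly (diag_mx d).
    by symmetry; apply: char_poly_intertwine Uunit _; rewrite US.
  rewrite char_poly_trig; last by apply: diag_mx_is_trig.
  rewrite rmorph_prod; apply: eq_bigr => i _.
  by rewrite /= map_polyXsubC {1}de !mxE eqxx.
- apply/matrixP => i k; rewrite mul_diag_mx !mxE.
  have := congr1 (@complex.Re R) (UE i k).
  have -> : d 0 i = (e 0 i)%:C%C by rewrite {1}de mxE.
  rewrite raddf_sum /= => E.
  case: (U i k) E => x y /=; rewrite mul0r subr0 => <-.
  by apply: eq_bigr => j _; rewrite !mxE; case: (U i j) => p q /=; rewrite mulr0 subr0.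
- apply/matrixP => i k; rewrite mul_diag_mx !mxE.
  have := congr1 (@complex.Im R) (UE i k).
  have -> : d 0 i = (e 0 i)%:C%C by rewrite {1}de mxE.
  rewrite raddf_sum /= => E.
  case: (U i k) E => x y /=; rewrite mul0r addr0 => <-.
  by apply: eq_bigr => j _; rewrite !mxE; case: (U i j) => p q /=; rewrite mulr0 add0r.
(* Normalization of the rows is the diagonal of [U U^* = 1]; the last claim is the real part of
   [U^* U = 1]. *)
- move=> i; have /unitarymxP/matrixP/(_ i i) := Uuni.
  rewrite !mxE eqxx => /(congr1 (@complex.Re R)); rewrite raddf_sum /= => <-.
  rewrite -big_split; apply: eq_bigr => j _; rewrite !mxE.
  by case: (U i j) => p q /=; rewrite mulrN opprK !expr2.
- have UU : map_mx Num.conj U^T *m U = 1%:M by rewrite -invmx_unitary // mulVmx.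
  apply/matrixP => j k; have /matrixP/(_ j k) := UU.
  rewrite !mxE => /(congr1 (@complex.Re R)); rewrite raddf_sum /= => E.
  transitivity (complex.Re ((j == k)%:R : R[i])); last by case: (j == k).
  rewrite -E -big_split; apply: eq_bigr => i _; rewrite !mxE.
  by case: (U i j) => p q; case: (U i k) => r s /=; rewrite mulNr opprK.
Qed.

(** * Dirichlet form and hitting times of reversible chains *)

(** The increment of the cubic is [a eps + c eps^2 + phi eps^3]. Testing it at [eps] and [- eps] and
    dividing by [eps] gives the two optimality conditions [a = 0] and [c <= 0] without
    differentiation. *)
Lemma cubic_local_max (R : realType) (t S G phi delta : R) : 0 < delta ->
  (forall eps, `|eps| < delta ->
     (t + eps) * (S - 2 * G * eps + phi * eps ^+ 2) <= t * S) ->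
  S = 2 * t * G /\ t * phi <= 2 * G.
Proof.
move=> delta_gt0 tmax; pose a := S - 2 * t * G; pose c := t * phi - 2 * G.
have tmaxE eps : `|eps| < delta -> a * eps + c * eps ^+ 2 + phi * eps ^+ 3 <= 0.
  move=> /tmax; rewrite -subr_le0; congr (_ <= _); rewrite /a /c; ring.
have pos eps : 0 < eps -> eps < delta ->
    a + c * eps + phi * eps ^+ 2 <= 0 /\ - a + c * eps - phi * eps ^+ 2 <= 0.
  move=> e0 ed; split.
    have := tmaxE eps; rewrite gtr0_norm // => /(_ ed).
    have -> : a * eps + c * eps ^+ 2 + phi * eps ^+ 3 =
      eps * (a + c * eps + phi * eps ^+ 2) by ring.
    by rewrite pmulr_rle0.
  have := tmaxE (- eps); rewrite normrN gtr0_norm // => /(_ ed).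
  have -> : a * (- eps) + c * (- eps) ^+ 2 + phi * (- eps) ^+ 3 =
    eps * (- a + c * eps - phi * eps ^+ 2) by ring.
  by rewrite pmulr_rle0.
have c_le0 : c <= 0.
  (* The sum of the two inequalities involves only [c]. *)
  have [] := pos (delta / 2); [by lra|by lra|] => h1 h2.
  have : c * delta <= 0 by nra.
  by rewrite pmulr_lle0.
split; last by move: c_le0; rewrite subr_le0.
apply/eqP; rewrite -subr_eq0 -/a; apply: contraT => a_neq0.
have a_gt0 : 0 < `|a| by rewrite normr_gt0.
have K_gt0 : 0 < `|c| + `|phi| * delta + 1.
  by rewrite ltr_wpDl // addr_ge0 // mulr_ge0 // ltW.
set K := `|c| + `|phi| * delta + 1 in K_gt0.
(* With this [eps] the terms in [c] and [phi] amount to at most half of [|a|], while [pos] forces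
   them to be at least [|a|]. *)
pose eps := Num.min (delta / 2) (`|a| / (2 * K)).
have eps_gt0 : 0 < eps by rewrite lt_min !divr_gt0 ?mulr_gt0.
have eps_delta : eps < delta.
  by rewrite gt_min; apply/orP; left; rewrite ltr_pdivrMr ?ltr0n //; lra.
have eps_a : K * eps <= `|a| / 2.
  have : eps <= `|a| / (2 * K) by rewrite ge_min lexx orbT.
  rewrite invfM mulrA ler_pdivlMr // => H; lra.
have [h1 h2] := pos _ eps_gt0 eps_delta.
have h3 : `|c * eps| + `|phi * eps ^+ 2| <= K * eps.
  rewrite 2!normrM (gtr0_norm eps_gt0) normrX (gtr0_norm eps_gt0) /K !mulrDl mul1r.
  have : `|phi| * eps ^+ 2 <= `|phi| * delta * eps.
    by rewrite -mulrA ler_wpM2l // expr2 ler_pM2r // ltW.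
  lra.
have := ler_norm (- (c * eps)); have := ler_norm (phi * eps ^+ 2).
have := ler_norm (- (phi * eps ^+ 2)); rewrite !normrN.
have : `|a| <= `|c * eps| + `|phi * eps ^+ 2|.
  by rewrite ler_norml; apply/andP; split;
    have := ler_norm (- (c * eps)); have := ler_norm (phi * eps ^+ 2);
    have := ler_norm (- (phi * eps ^+ 2)); rewrite !normrN; lra.
lra.
Qed.

(** Continuity in the level [s], required to apply the extreme value theorem to
    [s * pi((f - s)^+ ^ 2)]. *)
Lemma continuous_weighted_truncation (R : realType) (I : Type) (r : seq I)
    (c f : I -> R) :
  continuous (fun s => \sum_(x <- r) c x * Num.max (f x - s) 0 ^+ 2).
Proof.
elim: r => [|x r IHr] s.
  rewrite (_ : (fun _ => _) = fun=> 0); first exact: cvg_cst.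
  by apply/funext => u; rewrite big_nil.
rewrite (_ : (fun _ => _) = (fun s => c x * (Num.max (f x - s) 0 * Num.max (f x - s) 0) +
   \sum_(x <- r) c x * Num.max (f x - s) 0 ^+ 2)); last first.
  by apply/funext => u; rewrite big_cons expr2.
have cmax : {for s, continuous (fun s => Num.max (f x - s) 0)}.
  apply: (@continuous_max R R^o (fun s => f x - s) (fun=> 0)); last exact: cvg_cst.
  by apply: cvgB; [exact: cvg_cst|exact: cvg_id].
apply: cvgD; last exact: IHr.
by apply: cvgM; [exact: cvg_cst|apply: cvgM].
Qed.

Lemma tmx_exp_ge0 (R : realType) (V : finType) (P : V -> V -> R) n i j :
  transition_matrix P -> 0 <= (tmx P ^+ n) i j.
Proof.
move=> Ptrans; elim: n i j => [|n IHn] i j; first by rewrite expr0 mxE ler0n.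
rewrite exprS mxE; apply: sumr_ge0 => k _; apply: mulr_ge0 => //.
by rewrite mxE; case: (Ptrans (enum_val i)).
Qed.

Section ReversibleChain.
Context {R : realType} {V : finType} (P : V -> V -> R) (pi : V -> R).
Implicit Types (f g h : V -> R) (A : {set V}).
Hypotheses (Ptrans : transition_matrix P) (Pirr : irreducible P).
Hypotheses (Pstat : stationary P pi) (Prev : reversible P pi).

Definition mean f : R := \sum_x pi x * f x.

Definition transition f : V -> R := fun x => \sum_y P x y * f y.

Definition dirichlet f g : R := \sum_x pi x * (f x * (g x - transition g x)).

Lemma P_ge0 x y : 0 <= P x y. Proof. by case: (Ptrans x). Qed.

Lemma sum_transition x : \sum_y P x y = 1. Proof. by case: (Ptrans x). Qed.

Lemma sum_stationary : \sum_x pi x = 1. Proof. by case: Pstat => -[]. Qed.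

Lemma stationary_ge0 x : 0 <= pi x. Proof. by case: Pstat => -[]. Qed.

(** Some state [x] carries mass. Since [pi] is invariant under every power of [P], a path of
    positive probability from [x] to [y] transports part of that mass to [y]. *)
Lemma stationary_gt0 y : 0 < pi y.
Proof.
have [x pix] : exists x, 0 < pi x.
  have [|x pix] := @psumr_neq0P _ _ predT pi (fun x _ => stationary_ge0 x).
    by rewrite sum_stationary; apply/eqP; rewrite oner_eq0.
  by exists x.
have invar n : \row_i pi (enum_val i) *m (tmx P ^+ n) = \row_i pi (enum_val i).
  elim: n => [|n IHn]; first by rewrite expr0 mulmx1.
  rewrite exprSr mulmxA IHn; apply/rowP => j; rewrite !mxE.
  case: Pstat => _ <-; rewrite (reindex _ (onW_bij _ (@enum_val_bij V))) /=.
  by apply: eq_bigr => i _; rewrite !mxE.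
have [n xy] := Pirr x y.
have /rowP/(_ (enum_rank y)) := invar n; rewrite !mxE enum_rankK => <-.
rewrite (bigD1 (enum_rank x)) //= mxE enum_rankK.
apply: ltr_wpDr; last exact: mulr_gt0.
by apply: sumr_ge0 => i _; rewrite mxE mulr_ge0 ?stationary_ge0 ?tmx_exp_ge0.
Qed.

Lemma mean_transition f : mean (transition f) = mean f.
Proof.
rewrite /mean /transition; under eq_bigr do rewrite mulr_sumr.
rewrite exchange_big /=; apply: eq_bigr => y _.
by case: Pstat => _ <-; rewrite mulr_suml; apply: eq_bigr => x _; rewrite mulrA.
Qed.

(** Row sums equal to 1 turn the form into a double sum; by reversibility, averaging it with its
    copy where [x] and [y] are swapped gives the symmetric expression. *)
Lemma dirichletE f g :
  dirichlet f g =
  2^-1 * \sum_x \sum_y pi x * P x y * ((f x - f y) * (g x - g y)).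
Proof.
pose F x y := pi x * P x y * (f x * (g x - g y)).
have DF : dirichlet f g = \sum_x \sum_y F x y.
  apply: eq_bigr => x _; rewrite -[g x in LHS]mul1r -(sum_transition x) mulr_suml -sumrB.
  by rewrite !mulr_sumr; apply: eq_bigr => y _; rewrite /F; ring.
have DF' : dirichlet f g = \sum_x \sum_y F y x by rewrite DF exchange_big.
have two : (2 : R) != 0 by rewrite pnatr_eq0.
apply: (mulfI two); rewrite mulrA mulfV // mul1r.
rewrite mulr_natl mulr2n {1}DF DF' -big_split; apply: eq_bigr => x _ /=.
rewrite -big_split; apply: eq_bigr => y _ /=; rewrite /F Prev; ring.
Qed.

Lemma dirichletC f g : dirichlet f g = dirichlet g f.
Proof.
rewrite !dirichletE; congr (_ * _); apply: eq_bigr => x _.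
by apply: eq_bigr => y _; rewrite [X in _ * X]mulrC.
Qed.

Lemma dirichlet_ge0 f : 0 <= dirichlet f f.
Proof.
rewrite dirichletE mulr_ge0 ?invr_ge0 ?ler0n //; apply: sumr_ge0 => x _.
by apply: sumr_ge0 => y _; rewrite -expr2 mulr_ge0 ?sqr_ge0 // mulr_ge0 ?stationary_ge0 ?P_ge0.
Qed.

(** Zero energy forces [f] to agree across every edge of positive probability, and irreducibility
    joins any two states by such edges. *)
Lemma dirichlet_eq0 f : dirichlet f f = 0 -> forall x y, f x = f y.
Proof.
have term_ge0 x y : 0 <= pi x * P x y * ((f x - f y) * (f x - f y)).
  by rewrite -expr2 mulr_ge0 ?sqr_ge0 // mulr_ge0 ?stationary_ge0 ?P_ge0.
rewrite dirichletE => /eqP; rewrite mulf_eq0 invr_eq0 pnatr_eq0 /= => /eqP D0.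
have edge x y : 0 < P x y -> f x = f y.
  have row_ge0 z : true -> 0 <= \sum_t pi z * P z t * ((f z - f t) * (f z - f t)).
    by move=> _; apply: sumr_ge0 => t _; apply: term_ge0.
  have /(psumr_eq0P (fun y _ => term_ge0 x y)) row0 := psumr_eq0P row_ge0 D0 (isT : xpredT x).
  have /eqP E := row0 y isT => Pxy.
  move: E; rewrite mulf_eq0 mulf_eq0 (gt_eqF (stationary_gt0 x)) (gt_eqF Pxy) /=.
  by rewrite mulf_eq0 orbb subr_eq0 => /eqP.
have path n i j : 0 < (tmx P ^+ n) i j -> f (enum_val i) = f (enum_val j).
  elim: n i j => [|n IHn] i j.
    by rewrite expr0 mxE; case: eqP => [->|_] //; rewrite ltxx.
  rewrite exprS mxE => pos.
  have [||k /= pos_k] :=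
      @psumr_neq0P _ _ predT (fun k => tmx P i k * (tmx P ^+ n) k j).
  - by move=> k _; rewrite mulr_ge0 ?tmx_exp_ge0 // mxE P_ge0.
  - by apply/eqP; rewrite gt_eqF.
  have Pik : 0 < P (enum_val i) (enum_val k).
    rewrite lt_neqAle P_ge0 andbT; apply: contraTneq pos_k => E.
    by rewrite mxE -E mul0r ltxx.
  rewrite (edge _ _ Pik); apply: IHn; move: pos_k; rewrite mxE.
  by rewrite pmulr_rgt0.
by move=> x y; have [n /path] := Pirr x y; rewrite !enum_rankK.
Qed.

Lemma dirichlet_subZ (c : R) g h :
  dirichlet (fun x => g x - c * h x) (fun x => g x - c * h x) =
  dirichlet g g - 2 * c * dirichlet g h + c ^+ 2 * dirichlet h h.
Proof.
have transitionB x : transition (fun x => g x - c * h x) x = transition g x - c * transition h x.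
  by rewrite /transition mulr_sumr -sumrB; apply: eq_bigr => y _; ring.
rewrite mulr_natl mulr2n mulrDl {2}dirichletC opprD addrA /dirichlet.
rewrite !mulr_sumr -!sumrB -big_split /=; apply: eq_bigr => x _.
rewrite transitionB; ring.
Qed.

(* The linear system satisfied by the mean hitting times of [A]. *)
Definition hitting_solution A h : Prop :=
  [/\ forall x, 0 <= h x, forall x, x \in A -> h x = 0
    & forall x, x \notin A -> h x = 1 + transition h x].

Lemma dirichlet_hitting A h g : hitting_solution A h ->
  (forall x, x \in A -> g x = 0) -> dirichlet g h = mean g.
Proof.
case=> _ hA hB gA; apply: eq_bigr => x _.
have [xA|xA] := boolP (x \in A); first by rewrite gA // mul0r.
by rewrite hB // addrK mulr1.
Qed.

(** Uniqueness for the homogeneous system gives existence by finite dimension; nonnegativity then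
    follows from an energy argument on the negative part of the solution. *)
Lemma hitting_solution_exists A :
  A != finset.set0 -> exists h, hitting_solution A h.
Proof.
move=> /set0Pn[a aA].
pose rowf f := \row_i f (enum_val i) : 'rV[R]_#|V|.
(* The system matrix is transposed, so that functions act as row vectors and injectivity becomes
   [row_free]. *)
pose N : 'M[R]_#|V| :=
  \matrix_(j, i) ((j == i)%:R - (enum_val i \notin A)%:R * P (enum_val i) (enum_val j)).
have rowfN f i : (rowf f *m N) 0 i =
    f (enum_val i) - (enum_val i \notin A)%:R * transition f (enum_val i).
  rewrite mxE; under eq_bigr do rewrite !mxE mulrBr.
  rewrite sumrB; congr (_ - _).
    rewrite (bigD1 i) //= eqxx mulr1 big1 ?addr0 // => j /negPf ji.
    by rewrite ji mulr0.
  rewrite /transition (reindex _ (onW_bij _ (@enum_val_bij V))) /= mulr_sumr.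
  by apply: eq_bigr => j _; ring.
have rowfK (v : 'rV[R]_#|V|) : v = rowf (fun x => v 0 (enum_rank x)).
  by apply/rowP => i; rewrite !mxE enum_valK.
have Nfree : row_free N.
  apply: inj_row_free => v; pose f x := v 0 (enum_rank x).
  rewrite (rowfK v : v = rowf f) => fN; have fE x : f x = (x \notin A)%:R * transition f x.
    have /rowP/(_ (enum_rank x)) := fN; rewrite rowfN enum_rankK mxE.
    by move/eqP; rewrite subr_eq0 => /eqP.
  (* For [f] in the kernel, each term [f x * (f x - transition f x)] vanishes: its first factor on
     [A], its second off [A]. So [f] is constant, equal to its value 0 at [a]. *)
  have /dirichlet_eq0 fconst : dirichlet f f = 0.
    apply: big1 => x _; rewrite {1 2}fE; case: (x \notin A) => /=.
      by rewrite mul1r subrr !mulr0.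
    by rewrite mul0r mul0r mulr0.
  by apply/rowP => i; rewrite !mxE (fconst _ a) fE aA mul0r.
have /mulmxKV NK : N \in unitmx by rewrite -row_free_unit.
pose h x := (rowf (fun x => (x \notin A)%:R) *m invmx N) 0 (enum_rank x).
have hE x : h x - (x \notin A)%:R * transition h x = (x \notin A)%:R.
  have := rowfN h (enum_rank x); rewrite enum_rankK => <-.
  by rewrite -rowfK NK mxE enum_rankK.
have hA x : x \in A -> h x = 0.
  by move=> xA; have := hE x; rewrite xA /= mul0r subr0.
have hB x : x \notin A -> h x = 1 + transition h x.
  by move=> xA; have := hE x; rewrite xA /= mul1r => /eqP; rewrite subr_eq => /eqP.
(* Truncation gives [E(g, g) <= E(g, h) = pi(g)], so [pi(g) >= 0]; as [g <= 0] and [pi > 0], [g]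
   vanishes. *)
pose g x := Num.min (h x) 0.
have g_le0 x : g x <= 0 by rewrite ge_min lexx orbT.
have gh : dirichlet g h = mean g.
  apply: eq_bigr => x _; have [xA|xA] := boolP (x \in A).
    by rewrite /g hA // minxx mul0r.
  by rewrite hB // addrK mulr1.
have mean_g : 0 <= mean g.
  rewrite -gh (le_trans (dirichlet_ge0 g)) // !dirichletE.
  rewrite ler_wpM2l ?invr_ge0 ?ler0n //; apply: ler_sum => x _.
  apply: ler_sum => y _; rewrite ler_wpM2l ?mulr_ge0 ?stationary_ge0 ?P_ge0 //.
  by rewrite /g !minElt; case: ltP => ?; case: ltP => ?; nra.
have g0 x : g x = 0.
  have pg_ge0 y : true -> 0 <= - (pi y * g y).
    by rewrite -mulrN mulr_ge0 ?stationary_ge0 // oppr_ge0.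
  have /eqP : \sum_y - (pi y * g y) = 0.
    by apply/eqP; rewrite eq_le sumr_ge0 // andbT sumrN oppr_le0.
  move=> /eqP/(psumr_eq0P pg_ge0) E; have /eqP := E x isT.
  by rewrite oppr_eq0 mulf_eq0 gt_eqF ?stationary_gt0 //= => /eqP.
exists h; split=> // x; have := g0 x; rewrite /g minElt.
by case: (ltP (h x) 0) => // hx hx0; rewrite hx0 ltxx in hx.
Qed.

(** * Mean hitting times against the spectral gap *)

Lemma sum_setC A (u : V -> R) : (forall x, x \in A -> u x = 0) ->
  \sum_(x in ~: A) u x = \sum_x u x.
Proof.
move=> u0; rewrite [RHS](bigID [in A]) /= [X in _ = X + _]big1; last exact: u0.
by rewrite add0r; apply: eq_bigl => x; rewrite finset.in_setC.
Qed.

Lemma prob_setC A : prob_of pi (~: A)%SET = 1 - prob_of pi A.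
Proof.
apply/eqP; rewrite eq_sym subr_eq -sum_stationary (bigID [in A]) /= addrC.
by apply/eqP; congr (_ + _); apply: eq_bigl => x; rewrite inE.
Qed.

Lemma prob_gt0 A : A != finset.set0 -> 0 < prob_of pi A.
Proof.
move=> /set0Pn[a aA]; rewrite /prob_of (bigD1 a) //=.
by apply: ltr_wpDr; rewrite ?stationary_gt0 // sumr_ge0 // => x _; apply: stationary_ge0.
Qed.

(** The Poincare inequality for [h] is combined with Cauchy-Schwarz on the complement of [A]. The
    factor [prob_of pi A] is what remains of 1 after subtracting the squared mean. *)
Lemma mean_hitting_le (b : R) A h : b < 1 ->
  (forall f, (1 - b) * (mean (fun x => f x ^+ 2) - mean f ^+ 2) <= dirichlet f f) ->
  A \proper [set: V]%SET -> hitting_solution A h ->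
  (1 - b) * prob_of pi A * mean h <= prob_of pi (~: A)%SET.
Proof.
move=> b1 gap Aproper sol; have [h_ge0 hA hB] := sol.
have B_gt0 : 0 < prob_of pi (~: A)%SET.
  apply: prob_gt0; have [_ [x _ xA]] := properP Aproper.
  by apply/set0Pn; exists x; rewrite inE.
have m_ge0 : 0 <= mean h.
  by apply: sumr_ge0 => x _; rewrite mulr_ge0 ?stationary_ge0.
have := gap h; rewrite (dirichlet_hitting _ _ _ sol hA) //.
have PA : prob_of pi A = 1 - prob_of pi (~: A)%SET by rewrite prob_setC; ring.
set p := prob_of pi (~: A)%SET in B_gt0 PA *.
set m := mean h in m_ge0 *.
set q := mean (fun x => h x ^+ 2).
(* Cauchy-Schwarz: the sum of squares introduced below expands to [p * (q * p - m ^+ 2)]. *)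
have CS : m ^+ 2 <= q * p.
  have : 0 <= \sum_(x in ~: A) pi x * (p * h x - m) ^+ 2.
    by apply: sumr_ge0 => x _; rewrite mulr_ge0 ?stationary_ge0 ?sqr_ge0.
  have -> : \sum_(x in ~: A) pi x * (p * h x - m) ^+ 2 =
      p ^+ 2 * q - 2 * p * m * m + m ^+ 2 * p.
    have expand (c d : R) : \sum_(x in ~: A) pi x * (c * h x - d) ^+ 2 =
        c ^+ 2 * (\sum_(x in ~: A) pi x * h x ^+ 2)
        - 2 * c * d * (\sum_(x in ~: A) pi x * h x) + d ^+ 2 * \sum_(x in ~: A) pi x.
      by rewrite !mulr_sumr -sumrB -big_split /=; apply: eq_bigr => x _; ring.
    rewrite expand; congr (_ * _ - _ * _ + _); apply: sum_setC => x xA;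
      by rewrite hA // ?expr0n mulr0.
  move=> H; have : 0 <= p * (q * p - m ^+ 2) by rewrite (le_trans H) //; nra.
  by rewrite pmulr_rge0 // subr_ge0.
move=> G; rewrite PA.
have [-> |m0] := eqVneq m 0; first by rewrite mulr0 ltW.
have m_gt0 : 0 < m by rewrite lt_neqAle eq_sym m0.
have G2 : (1 - b) * (q * p - m ^+ 2 * p) <= m * p by nra.
have G3 : (1 - b) * (m ^+ 2 - m ^+ 2 * p) <= m * p.
  by apply: le_trans G2; rewrite ler_pM2l ?subr_gt0 // lerD2r.
rewrite -(ler_pM2l m_gt0); apply: le_trans G3; rewrite le_eqVlt; apply/orP; left.
by apply/eqP; ring.
Qed.

(** Cauchy-Schwarz for the Dirichlet form, with [E(g, h) = pi(g)] and [E(h, h) = pi(h)]: the energy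
    of [g - c h] is nonnegative at its minimizer [c = pi(g) / pi(h)]. *)
Lemma dirichlet_le_hitting A h g : hitting_solution A h ->
  A \proper [set: V]%SET -> (forall x, x \in A -> g x = 0) ->
  mean g ^+ 2 <= dirichlet g g * mean h.
Proof.
move=> sol Aproper gA; have [h_ge0 hA hB] := sol.
have m_gt0 : 0 < mean h.
  have [_ [x _ xA]] := properP Aproper.
  rewrite /mean (bigD1 x) //= ltr_wpDr //.
    by apply: sumr_ge0 => y _; rewrite mulr_ge0 ?stationary_ge0.
  rewrite mulr_gt0 ?stationary_gt0 // hB //; apply: ltr_wpDr => //.
  by apply: sumr_ge0 => y _; rewrite mulr_ge0 ?P_ge0.
have := dirichlet_ge0 (fun x => g x - mean g / mean h * h x).
rewrite dirichlet_subZ (dirichlet_hitting _ _ _ sol gA).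
rewrite (dirichlet_hitting _ _ _ sol hA) => H.
rewrite -ler_pdivrMr // -subr_ge0; apply: le_trans H _.
rewrite le_eqVlt; apply/orP; left; apply/eqP; field.
by rewrite gt_eqF.
Qed.

Lemma superlevel_hitting (b : R) f :
  b < 1 -> (forall x, transition f x = b * f x) -> (exists x, 0 < f x) ->
  exists t, 0 < t /\
    let A := [set x | f x <= t]%SET in
    A \proper [set: V]%SET /\
    forall h, hitting_solution A h ->
      prob_of pi (~: A)%SET <= 6 * (1 - b) * mean h.
Proof.
move=> b1 fE [x0 fx0].
pose trunc s x := Num.max (f x - s) 0.
pose F s := s * \sum_x pi x * trunc s x ^+ 2.
pose M := \sum_x `|f x|.
have f_le_M x : f x <= M.
  rewrite (le_trans (ler_norm _)) // /M (bigD1 x) //= lerDl.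
  by apply: sumr_ge0.
(* [F] vanishes at 0 and is positive at [f x0 / 2], so the maximizer is positive and some state lies
   above it. *)
have [t] : exists2 t, t \in `[0, M] & forall s, s \in `[0, M] -> F s <= F t.
  apply: EVT_max; first by rewrite (le_trans (ltW fx0)).
  apply: continuous_subspaceT => s; apply: cvgM; first exact: cvg_id.
  exact: continuous_weighted_truncation.
rewrite in_itv /= => /andP[t_ge0 tM] tmax.
have Ft_gt0 : 0 < F t.
  have F0 : 0 < F (f x0 / 2).
    rewrite mulr_gt0 ?divr_gt0 // (bigD1 x0) //= ltr_wpDr //.
      by apply: sumr_ge0 => x _; rewrite mulr_ge0 ?stationary_ge0 ?sqr_ge0.
    rewrite mulr_gt0 ?stationary_gt0 // exprn_gt0 // lt_max; apply/orP; left; lra.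
  apply: lt_le_trans F0 (tmax _ _); have := f_le_M x0 => Mx0.
  by rewrite in_itv /=; apply/andP; split; lra.
have t_gt0 : 0 < t.
  by rewrite lt_neqAle t_ge0 andbT; apply: contraTneq Ft_gt0 => <-; rewrite /F mul0r ltxx.
exists t; split=> //; set A := [set x | f x <= t]%SET.
have inA x : (x \in A) = (f x <= t) by rewrite inE.
have truncA x : x \in A -> trunc t x = 0.
  by rewrite inA /trunc => xt; rewrite max_r // subr_le0.
have truncB x : x \notin A -> trunc t x = f x - t.
  by rewrite inA -ltNge /trunc => xt; rewrite max_l // subr_ge0 ltW.
have Aproper : A \proper [set: V]%SET.
  rewrite properT; apply: contraTneq Ft_gt0 => AT.
  rewrite /F big1 ?mulr0 ?ltxx // => x _.
  by rewrite truncA ?AT ?inE // expr0n mulr0.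
split=> // h sol.
pose S := \sum_(x in ~: A) pi x * (f x - t) ^+ 2.
pose G := \sum_(x in ~: A) pi x * (f x - t).
set phi := prob_of pi _.
(* Moving the level by less than [delta] keeps it in [[0, M]] (the initial value [t] of the minimum
   handles the lower end) and keeps all states outside [A] above it. *)
pose delta := \big[Num.min/t]_(x in ~: A) (f x - t).
have delta_gt0 : 0 < delta.
  by apply: lt_bigmin => // x; rewrite finset.in_setC inA -ltNge subr_gt0.
have delta_le x : x \notin A -> delta <= f x - t.
  by move=> xA; apply: bigmin_le_cond; rewrite finset.in_setC.
have FtE : F t = t * S.
  rewrite /F -(sum_setC A) => [|x xA]; last by rewrite truncA // expr0n mulr0.
  by congr (_ * _); apply: eq_bigr => x; rewrite finset.in_setC => xA; rewrite truncB.
have [SE phiG] : S = 2 * t * G /\ t * phi <= 2 * G.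
  apply: (cubic_local_max _ _ _ _ _ _ delta_gt0) => eps eps_delta.
  have [eps_lo eps_hi] : - delta < eps /\ eps < delta.
    by move: eps_delta; rewrite ltr_norml => /andP[].
  have delta_t : delta <= t by apply: bigmin_le_id.
  have [_ [y _ yA]] := properP Aproper.
  have := f_le_M y; have := delta_le y yA => dy My.
  rewrite -FtE; apply: le_trans (tmax (t + eps) _); last first.
    by rewrite in_itv /=; apply/andP; split; lra.
  rewrite /F ler_wpM2l //; first lra.
  (* A lower level may also expose states of [A]. Their contribution is nonnegative, so the cubic is
     a lower bound for [F], with equality at [eps = 0]. *)
  rewrite [leRHS](bigID [in A]) /= -[leLHS]add0r lerD //.
    by apply: sumr_ge0 => x _; rewrite mulr_ge0 ?stationary_ge0 ?sqr_ge0.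
  have -> : S - 2 * G * eps + phi * eps ^+ 2 =
      \sum_(x in ~: A) pi x * (f x - (t + eps)) ^+ 2.
    rewrite /S /G /phi /prob_of mulr_sumr !mulr_suml -sumrB -big_split /=.
    by apply: eq_bigr => x _; ring.
  rewrite le_eqVlt; apply/orP; left; apply/eqP.
  apply: eq_big => x; first by rewrite finset.in_setC.
  rewrite finset.in_setC => xA; rewrite /trunc max_l //; have := delta_le x xA; lra.
have meanE : mean (trunc t) = G.
  rewrite /mean -(sum_setC A) => [|x xA]; last by rewrite truncA // mulr0.
  by apply: eq_bigr => x; rewrite finset.in_setC => xA; rewrite truncB.
have trunc_ge0 x : 0 <= trunc t x by rewrite le_max lexx orbT.
(* Outside [A], [transition (trunc t) >= b f - t], hence [trunc t - transition (trunc t) <= (1 - b)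
   f]. Writing [f = (f - t) + t] gives [S + t G], which is [3 t G] by the first-order condition. *)
have energy : dirichlet (trunc t) (trunc t) <= 3 * (1 - b) * t * G.
  have -> : 3 * (1 - b) * t * G = (1 - b) * (S + t * G) by rewrite SE; ring.
  rewrite /dirichlet -(sum_setC A) => [|x xA]; last by rewrite truncA // mul0r mulr0.
  rewrite /S /G mulr_sumr -big_split mulr_sumr /=; apply: ler_sum => x.
  rewrite finset.in_setC => xA.
  have : b * f x - t <= transition (trunc t) x.
    have -> : b * f x - t = \sum_y P x y * (f y - t).
      under eq_bigr do rewrite mulrBr.
      by rewrite sumrB -mulr_suml sum_transition mul1r -fE.
    by apply: ler_sum => y _; rewrite ler_wpM2l ?P_ge0 // le_max lexx.
  rewrite truncB // => H; have : 0 <= f x - t by rewrite subr_ge0 ltW // ltNge -inA.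
  move=> ft_ge0; apply: (@le_trans _ _ (pi x * ((f x - t) * ((1 - b) * f x)))).
    by rewrite ler_wpM2l ?stationary_ge0 // ler_wpM2l //; lra.
  by rewrite le_eqVlt; apply/orP; left; apply/eqP; ring.
have G_ge0 : 0 <= G.
  rewrite -meanE /mean; apply: sumr_ge0 => x _; rewrite mulr_ge0 ?stationary_ge0 //.
have := dirichlet_le_hitting _ _ _ sol Aproper truncA; rewrite meanE => CS.
have m_ge0 : 0 <= mean h.
  by have [h0 _ _] := sol; apply: sumr_ge0 => x _; rewrite mulr_ge0 ?stationary_ge0.
have {CS} GG : G * G <= G * (3 * (1 - b) * t * mean h).
  rewrite -expr2 (le_trans CS) // (le_trans (ler_wpM2r m_ge0 energy)) //.
  by rewrite le_eqVlt; apply/orP; left; apply/eqP; ring.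
have G_gt0 : 0 < G.
  have : 0 < t * S by rewrite -FtE.
  by rewrite SE; move: G_ge0; rewrite le_eqVlt => /orP[/eqP <-|//]; rewrite !mulr0 ltxx.
(* Cancelling [G] leaves [G <= 3 (1 - b) t pi(h)]; with [t * phi <= 2 * G] this produces the
   constant 6. *)
rewrite ler_pM2l // in GG.
by rewrite -(ler_pM2l t_gt0); apply: le_trans phiG _; lra.
Qed.

(** One of [f] and [- f] is nonpositive on a set of mass at least 1/2, and the sublevel set at a
    positive [t] contains that set. *)
Lemma mean_hitting_ge (b : R) f : b < 1 ->
  (forall x, transition f x = b * f x) -> mean f = 0 -> (exists x, f x != 0) ->
  exists A, [/\ A \proper [set: V]%SET, 2^-1 <= prob_of pi A &
    forall h, hitting_solution A h ->
      prob_of pi (~: A)%SET <= 6 * (1 - b) * mean h].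
Proof.
move=> b1.
have half g : prob_of pi [set x | g x <= 0]%SET >= 2^-1 -> (forall x, transition g x = b * g x) ->
    mean g = 0 -> (exists x, g x != 0) ->
  exists A, [/\ A \proper [set: V]%SET, 2^-1 <= prob_of pi A &
    forall h, hitting_solution A h ->
      prob_of pi (~: A)%SET <= 6 * (1 - b) * mean h].
  move=> g_half gE g_mean [z gz].
  have [|t [t_gt0 /= [Aproper Ah]]] := superlevel_hitting b g b1 gE.
    (* A nonpositive function of mean zero vanishes, because [pi] charges every state. *)
    apply/existsP; apply: contraNT gz => /existsPn g_le0.
    have nonneg x : true -> 0 <= - (pi x * g x).
      by rewrite -mulrN mulr_ge0 ?stationary_ge0 // oppr_ge0 leNgt.
    have sum0 : \sum_x - (pi x * g x) = 0 by rewrite sumrN -/(mean g) g_mean oppr0.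
    have /eqP := psumr_eq0P nonneg sum0 (isT : xpredT z).
    by rewrite oppr_eq0 mulf_eq0 gt_eqF ?stationary_gt0.
  exists [set x | g x <= t]%SET; split=> //; apply: le_trans g_half _.
  rewrite /prob_of [leRHS](bigID (fun x => g x <= 0)) /= -[leLHS]addr0 lerD //.
    rewrite le_eqVlt; apply/orP; left; apply/eqP; apply: eq_bigl => x.
    rewrite !inE; case: (leP (g x) 0) => [gx|]; last by rewrite andbF.
    by rewrite andbT (le_trans gx) // ltW.
  by apply: sumr_ge0 => x _; apply: stationary_ge0.
move=> fE f_mean f_neq0.
have [|small] := leP 2^-1 (prob_of pi [set x | f x <= 0]%SET).
  by move=> f_half; apply: (half f).
apply: (half (fun x => - f x)); last 1 first.
- by have [x fx] := f_neq0; exists x; rewrite oppr_eq0.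
- apply: le_trans (_ : prob_of pi (~: [set x | f x <= 0])%SET <= _).
    rewrite prob_setC; lra.
  rewrite /prob_of big_mkcond [leRHS]big_mkcond; apply: ler_sum => x _.
  rewrite !inE oppr_le0; case: (leP (f x) 0) => [_|fx] /=; last by rewrite (ltW fx).
  by case: ifP => // _; apply: stationary_ge0.
- move=> x; rewrite mulrN -fE /transition -sumrN; apply: eq_bigr => y _; exact: mulrN.
- by rewrite /mean; under eq_bigr do rewrite mulrN; rewrite sumrN -/(mean f) f_mean oppr0.
Qed.

(** * The second eigenvalue, its eigenfunctions and the Poincare inequality *)

Lemma spectral_gap : (2 <= #|V|)%N ->
  [/\ beta2 P < 1,
      exists f, [/\ exists x, f x != 0, mean f = 0
                  & forall x, transition f x = beta2 P * f x]
    & forall f, (1 - beta2 P) * (mean (fun x => f x ^+ 2) - mean f ^+ 2)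
                <= dirichlet f f].
Proof.
move=> cardV; pose sq x := Num.sqrt (pi x).
have sq_gt0 x : 0 < sq x by rewrite sqrtr_gt0 stationary_gt0.
have sq_neq0 x : sq x != 0 by rewrite gt_eqF.
have sqE x : pi x = sq x * sq x by rewrite -expr2 sqr_sqrtr ?stationary_ge0.
(* Conjugating [P] by the diagonal matrix of [sqrt pi] makes it symmetric, by reversibility. An
   eigenvector [u] of [S] corresponds to the eigenfunction [u / sqrt pi] of [P]. *)
pose S : 'M[R]_#|V| :=
  \matrix_(i, j) (sq (enum_val i) * P (enum_val i) (enum_val j) / sq (enum_val j)).
have symS : S^T = S.
  apply/matrixP => i j; rewrite !mxE; set x := enum_val i; set y := enum_val j.
  have := Prev x y; rewrite !sqE => rev.
  apply/eqP; rewrite eqr_div //; apply/eqP; lra.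
have sumV (F : V -> R) : \sum_x F x = \sum_(i < #|V|) F (enum_val i).
  by rewrite (reindex _ (onW_bij _ (@enum_val_bij V))).
have [e [A [B [charS AS BS normAB pars]]]] := symmetric_spectral _ _ S symS.
pose fn (u : 'rV[R]_#|V|) : V -> R := fun x => u 0 (enum_rank x) / sq x.
have fn_eigen (u : 'rV_#|V|) b : u *m S = b *: u -> forall x, transition (fn u) x = b * fn u x.
  move=> uS x; have /rowP/(_ (enum_rank x)) := uS; rewrite !mxE => E.
  rewrite /fn mulrA -E mulr_suml /transition sumV; apply: eq_bigr => i _.
  have /matrixP/(_ i (enum_rank x)) := symS; rewrite !mxE !enum_rankK !enum_valK => <-.
  have := sq_neq0 x; have := sq_neq0 (enum_val i) => ? ?; field; exact/andP.
have mean_sqr_fn (u : 'rV_#|V|) : mean (fun x => fn u x ^+ 2) = \sum_j u 0 j ^+ 2.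
  rewrite /mean sumV; apply: eq_bigr => i _; rewrite /fn enum_valK sqE.
  by field.
have eigen_row i : row i A *m S = e 0 i *: row i A /\ row i B *m S = e 0 i *: row i B.
  by split; rewrite -row_mul ?AS ?BS; apply/rowP => j; rewrite mxE mul_diag_mx !mxE.
(* The energy of an eigenfunction is [1 - b] times its squared norm, hence [b <= 1]; if [b = 1] the
   energy is zero and the eigenfunction constant. *)
have eigen_le1 (u : 'rV_#|V|) b : u *m S = b *: u -> u != 0 ->
    b <= 1 /\ (b = 1 -> exists c, forall j, u 0 j = c * sq (enum_val j)).
  move=> /fn_eigen uE u_neq0.
  have DE : dirichlet (fn u) (fn u) = (1 - b) * mean (fun x => fn u x ^+ 2).
    by rewrite /mean mulr_sumr; apply: eq_bigr => x _; rewrite uE; ring.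
  have norm_gt0 : 0 < mean (fun x => fn u x ^+ 2).
    have [j uj] := rV0Pn _ u_neq0; rewrite mean_sqr_fn (bigD1 j) //= ltr_wpDr //.
      by apply: sumr_ge0 => k _; apply: sqr_ge0.
    by rewrite lt_neqAle sqr_ge0 eq_sym sqrf_eq0 uj.
  split.
    by have := dirichlet_ge0 (fn u); rewrite DE pmulr_lge0 // subr_ge0.
  move=> b1; have /dirichlet_eq0 const : dirichlet (fn u) (fn u) = 0.
    by rewrite DE b1 subrr mul0r.
  have x0 : V by apply: (@enum_val V predT (Ordinal (ltnW cardV))).
  exists (fn u x0) => j; rewrite (const x0 (enum_val j)) /fn enum_valK.
  by rewrite divfK.
have AB_neq0 i : row i A != 0 \/ row i B != 0.
  have [A0|] := eqVneq (row i A) 0; last by left.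
  right; apply: contraTneq (oner_neq0 R) => B0; rewrite negbK -(normAB i).
  rewrite !big1 ?addr0 // => j _.
    by have /rowP/(_ j) := B0; rewrite !mxE => ->; rewrite expr0n.
  by have /rowP/(_ j) := A0; rewrite !mxE => ->; rewrite expr0n.
have e_le1 i : e 0 i <= 1.
  by have [AS_i BS_i] := eigen_row i; case: (AB_neq0 i) => /eigen_le1 H;
    have [] := H _ ltac:(eassumption).
(* [w i v] is the squared modulus of the [i]-th coordinate of [v] in the complex orthonormal
   eigenbasis, so Parseval holds and [v^T S v] is diagonal in these weights. *)
pose w i (v : 'cV[R]_#|V|) := (A *m v) i 0 ^+ 2 + (B *m v) i 0 ^+ 2.
have w_ge0 i v : 0 <= w i v by rewrite addr_ge0 ?sqr_ge0.
pose q : 'cV[R]_#|V| := \col_i sq (enum_val i).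
(* At eigenvalue 1 the real and imaginary rows are multiples [a q] and [b q] of [q = sqrt pi], and
   normalization gives [a^2 + b^2 = 1]. *)
have w_top i : e 0 i = 1 -> forall v, w i v = (\sum_j q j 0 * v j 0) ^+ 2.
  move=> ei v.
  have top (C : 'M[R]_#|V|) : row i C *m S = e 0 i *: row i C ->
      exists c, forall j, C i j = c * q j 0.
    move=> CS; have [C0|/(eigen_le1 _ _ CS)[_ /(_ ei)[c cE]]] := eqVneq (row i C) 0.
      by exists 0 => j; have /rowP/(_ j) := C0; rewrite !mxE mul0r.
    by exists c => j; have := cE j; rewrite !mxE.
  have [/top[a aE] /top[b bE]] := eigen_row i.
  have qq : \sum_j q j 0 ^+ 2 = 1.
    by rewrite -sum_stationary sumV; apply: eq_bigr => j _; rewrite mxE sqE expr2.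
  have ab : a ^+ 2 + b ^+ 2 = 1.
    rewrite -(normAB i); under eq_bigr do rewrite aE exprMn.
    under [X in _ = _ + X]eq_bigr do rewrite bE exprMn.
    by rewrite -!mulr_sumr qq !mulr1.
  rewrite /w !mxE; under eq_bigr do rewrite aE -mulrA.
  under [X in _ + X ^+ 2 = _]eq_bigr do rewrite bE -mulrA.
  by rewrite -!mulr_sumr !exprMn -mulrDl ab mul1r.
have sum_w v : \sum_i w i v = \sum_j v j 0 ^+ 2.
  have : ((A *m v)^T *m (A *m v) + (B *m v)^T *m (B *m v)) = v^T *m v.
    by rewrite !trmx_mul -!mulmxA -mulmxDr !mulmxA -mulmxDl pars mul1mx.
  move=> /matrixP/(_ 0 0); rewrite !mxE -big_split /= => E.
  transitivity (\sum_j v^T 0 j * v j 0).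
    by rewrite -E; apply: eq_bigr => i _; rewrite /w !mxE !expr2.
  by apply: eq_bigr => j _; rewrite mxE expr2.
have sum_ew v : \sum_i e 0 i * w i v = (v^T *m S *m v) 0 0.
  have -> : v^T *m S *m v = (A *m v)^T *m diag_mx e *m (A *m v) +
       (B *m v)^T *m diag_mx e *m (B *m v).
    rewrite -[S]mul1mx -pars mulmxDl -!mulmxA AS BS !trmx_mul mulmxDl mulmxDr.
    by rewrite !mulmxA.
  rewrite mxE !mul_mx_diag !mxE -big_split; apply: eq_bigr => i _ /=.
  by rewrite /w !mxE; ring.
have qq : \sum_j q j 0 * q j 0 = 1.
  by rewrite -sum_stationary sumV; apply: eq_bigr => j _; rewrite mxE sqE.
have Sq : S *m q = q.
  apply/colP => i; rewrite !mxE -[RHS]mulr1 -(sum_transition (enum_val i)) sumV mulr_sumr.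
  by apply: eq_bigr => j _; rewrite !mxE divfK.
(* [q] is a unit vector fixed by [S]; its coordinates at eigenvalues other than 1 vanish, so some
   eigenvalue is 1. *)
have [i0 ei0] : exists i, e 0 i = 1.
  have : \sum_i w i q != 0.
    by rewrite sum_w; under eq_bigr do rewrite expr2; rewrite qq oner_neq0.
  have [/existsP[i /eqP ei]|/existsPn e_neq1] := boolP [exists i, e 0 i == 1].
    by exists i.
  apply: contraNP => _.
  have kill (C : 'M[R]_#|V|) i : C *m S = diag_mx e *m C -> (C *m q) i 0 = 0.
    move=> CS; have : C *m S *m q = C *m q by rewrite -mulmxA Sq.
    rewrite CS -mulmxA => /matrixP/(_ i 0); rewrite mul_diag_mx mxE => /eqP.
    rewrite -subr_eq0 -[X in _ - X == _]mul1r -mulrBl mulf_eq0 subr_eq0.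
    by rewrite (negPf (e_neq1 i)) => /eqP.
  by apply/eqP; apply: big1 => i _; rewrite /w !kill // expr0n addr0.
(* Each index of eigenvalue 1 takes weight 1 from [q], whose total weight is 1, so 1 is a simple
   eigenvalue. *)
have e_lt1 i : i != i0 -> e 0 i < 1.
  move=> ii0; rewrite lt_neqAle e_le1 andbT; apply: contra ii0 => /eqP ei.
  apply: contraT => ii0; have : \sum_k w k q = 1.
    by rewrite sum_w -[RHS]qq; apply: eq_bigr => j _; rewrite expr2.
  rewrite (bigD1 i0) //= (bigD1 i) //= !w_top // qq expr1n.
  have : 0 <= \sum_(k | (k != i0) && (k != i)) w k q by apply: sumr_ge0.
  lra.
pose s := sort >=%R [seq e 0 i | i <- enum (predC1 i0)].
have ge_total : total (>=%R : rel R) by move=> x y; exact: le_total.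
have ge_trans : transitive (>=%R : rel R) by move=> y x z /= yx zy; exact: le_trans zy yx.
have ge_anti : antisymmetric (>=%R : rel R).
  by move=> x y /= /andP[yx xy]; apply: le_anti; rewrite xy yx.
(* [1 :: s] meets the specification behind [xget], and a sorted list is determined by the product of
   its linear factors. *)
have sE : eigenvalues P = 1 :: s.
  pose spec := [set s : seq R | sorted >=%R s /\
                  char_poly (tmx P) = \prod_(b <- s) ('X - b%:P)]%classic.
  have spec_s : spec (1 :: s).
    split=> /=.
      rewrite path_min_sorted ?sort_sorted //; apply/allP => b.
      by rewrite mem_sort => /mapP[i _ ->] /=.
    rewrite big_cons (perm_big _ (permEl (perm_sort _ _))) /= big_map.
    rewrite big_enum_cond -ei0 /=.
    transitivity (char_poly S).
      pose Dg : 'M[R]_#|V| := diag_mx (\row_i sq (enum_val i)).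
      symmetry; apply: (@char_poly_intertwine _ _ _ _ Dg).
        by rewrite unitmxE det_diag unitfE; apply/prodf_neq0 => i _; rewrite mxE.
      by apply/matrixP => i j; rewrite mul_mx_diag mul_diag_mx !mxE divfK.
    rewrite charS (bigD1 i0) //=; congr (_ * _).
    by apply: eq_bigl => i; rewrite andbT.
  have [srt prd] : spec (eigenvalues P) by apply: xgetPex; exists (1 :: s).
  have [srt' prd'] := spec_s.
  by apply: (sorted_eq ge_trans ge_anti srt srt'); apply: prod_XsubC_eq; rewrite -prd -prd'.
have beta_s : beta2 P \in s /\ forall i, i != i0 -> e 0 i <= beta2 P.
  have : size s = #|V|.-1.
    by rewrite size_sort size_map -cardE cardC1 card_ord.
  have : sorted >=%R s by apply: sort_sorted.
  have mem_s i : i != i0 -> e 0 i \in s.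
    by move=> ii0; rewrite mem_sort map_f // mem_enum.
  move: mem_s; rewrite /beta2 sE /=; case: (s) => [|b s'] mem_s /=.
    by move=> _ /esym/eqP; rewrite -subn1 subn_eq0 leqNgt cardV.
  move=> srt _; split; first exact: mem_head.
  move=> i /mem_s; rewrite inE => /orP[/eqP-> //|].
  exact: (allP (order_path_min ge_trans srt)).
have [i1 i1i0 beta_e] : exists2 i, i != i0 & beta2 P = e 0 i.
  have [beta_in _] := beta_s; rewrite mem_sort in beta_in.
  have [i ii0 ->] := seq.mapP beta_in.
  by exists i => //; rewrite mem_enum in ii0.
have b1 : beta2 P < 1 by rewrite beta_e e_lt1.
split=> //.
- have [u u_neq0 uS] : exists2 u : 'rV_#|V|, u != 0 & u *m S = e 0 i1 *: u.
    by have [? ?] := eigen_row i1; case: (AB_neq0 i1) => ?;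
      [exists (row i1 A)|exists (row i1 B)].
  have fE := fn_eigen _ _ uS.
  exists (fn u); split.
  + have [j uj] := rV0Pn _ u_neq0; exists (enum_val j).
    by rewrite /fn enum_valK mulf_neq0 ?invr_eq0.
  (* Invariance of [pi] gives [beta2 * pi(f) = pi(f)] with [beta2 < 1], hence [pi(f) = 0]. *)
  + have : mean (transition (fn u)) = mean (fn u) by apply: mean_transition.
    have -> : mean (transition (fn u)) = e 0 i1 * mean (fn u).
      by rewrite /mean mulr_sumr; apply: eq_bigr => x _; rewrite fE mulrCA.
    move/eqP; rewrite -subr_eq0 -[X in _ - X == _]mul1r -mulrBl mulf_eq0 subr_eq0.
    by rewrite lt_eqF ?e_lt1 //= => /eqP.
  + by move=> x; rewrite fE beta_e.
(* In the coordinates of [sqrt pi * f] the top weight is [pi(f)^2], so the variance is the sum of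
   the other weights, and the inequality holds term by term. *)
- move=> f; pose v : 'cV[R]_#|V| := \col_i (sq (enum_val i) * f (enum_val i)).
  have vv : mean (fun x => f x ^+ 2) = \sum_i w i v.
    by rewrite sum_w /mean sumV; apply: eq_bigr => i _; rewrite mxE sqE; ring.
  have vSv : dirichlet f f = \sum_i (1 - e 0 i) * w i v.
    under eq_bigr do rewrite mulrBl mul1r.
    rewrite sumrB sum_ew -vv /mean !sumV -mulmxA.
    have Sv : S *m v = \col_i (sq (enum_val i) * transition f (enum_val i)).
      apply/colP => i; rewrite !mxE /transition sumV mulr_sumr; apply: eq_bigr => j _.
      by rewrite !mxE; have := sq_neq0 (enum_val j) => ?; field.
    rewrite Sv mxE -sumrB /dirichlet sumV; apply: eq_bigr => i _.
    by rewrite !mxE sqE; ring.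
  have w0 : w i0 v = mean f ^+ 2.
    rewrite w_top // /mean sumV; congr (_ ^+ 2); apply: eq_bigr => j _.
    by rewrite !mxE mulrA sqE.
  rewrite vSv vv (bigD1 i0) //= w0 addrAC subrr add0r mulr_sumr.
  rewrite [leRHS](bigD1 i0) //= ei0 subrr mul0r add0r; apply: ler_sum => i ii0.
  by rewrite ler_wpM2r // lerB //; case: beta_s => _; apply.
Qed.

End ReversibleChain.

(** * Expected hitting time of a Markov chain *)

Section FiniteValued.
Local Open Scope classical_set_scope.
Context {d : measure_display} {Omega : measurableType d} {R : realType}.
Context {I : finType} (Y : Omega -> I).
Hypothesis Y_meas : forall i, measurable [set w | Y w = i].

Lemma measurable_finite_valued (H : pred I) : measurable [set w | H (Y w)].
Proof.
rewrite (_ : [set w | _] = \bigcup_(i in [set i | H i]) [set w | Y w = i]).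
  by apply: fin_bigcup_measurable => //; apply: finite_finpred.
by apply/seteqP; split=> [w /= Hw|w [i /= Hi ->]//]; exists (Y w).
Qed.

Lemma measure_fibers (mu : {measure set Omega -> \bar R}) (E : set Omega) :
  measurable E -> mu E = (\sum_i mu (E `&` [set w | Y w = i]))%E.
Proof.
move=> E_meas.
have fiber (s : seq I) : uniq s ->
    mu (E `&` [set w | Y w \in s]) = (\sum_(i <- s) mu (E `&` [set w | Y w = i]))%E.
  elim: s => [_|i s IHs /= /andP[i_s /IHs {}IHs]].
    by rewrite big_nil (_ : [set w | _] = set0) ?setI0 ?measure0 //; apply/seteqP; split.
  rewrite big_cons -IHs -measureU.
  - congr (mu _); rewrite -setIUr; congr (_ `&` _); apply/seteqP; split=> w /=.
      by rewrite inE => /orP[/eqP|]; [left|right].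
    by rewrite inE => -[->|->]; rewrite ?eqxx ?orbT.
  - by apply: measurableI => //; apply: Y_meas.
  - by apply: measurableI => //; apply: (measurable_finite_valued [in s]).
  - by apply/seteqP; split=> // w /= [[_ ->] [_]]; rewrite (negPf i_s).
rewrite -big_enum /= -fiber ?enum_uniq //; congr (mu _).
by apply/seteqP; split=> [w Ew|w []//]; split=> //=; rewrite mem_enum.
Qed.
End FiniteValued.

Lemma conditioned_is_distr (R : realType) (V : finType) (mu : V -> R) (D : {set V}) :
  (forall x, 0 <= mu x) -> 0 < prob_of mu D -> is_distr (conditioned mu D).
Proof.
move=> mu_ge0 D_gt0; split=> [x|].
  by rewrite /conditioned; case: ifP => // _; rewrite divr_ge0 // ltW.
rewrite /conditioned -big_mkcond -mulr_suml mulfV //.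
by rewrite gt_eqF.
Qed.

Section HittingTime.
Local Open Scope classical_set_scope.
Context {R : realType} {V : finType} (P : V -> V -> R) (mu : V -> R).
Context {d : measure_display} {Omega : measurableType d}.
Context (Pr : probability Omega R) (X : nat -> Omega -> V) (A : {set V}).
Hypotheses (Ptrans : transition_matrix P) (mu_distr : is_distr mu).
Hypothesis X_chain : markov_chain P mu Pr X.

(** The past is recorded in a finite type, so that events about it split into finitely many
    cylinders. *)
Definition history n w : {ffun 'I_n.+1 -> V} := [ffun i : 'I_n.+1 => X i w].

Lemma history_cylinder n (c : {ffun 'I_n.+1 -> V}) :
  [set w | history n w = c] = [set w | forall i, (i <= n)%N -> X i w = c (inord i)].
Proof.
apply/seteqP; split=> w /=.
  by move=> <- i i_n; rewrite ffunE inordK.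
by move=> wc; apply/ffunP => i; rewrite ffunE wc -1?ltnS // inord_val.
Qed.

Lemma measurable_history n c : measurable [set w | history n w = c].
Proof.
have [X_meas _ _] := X_chain.
rewrite (_ : [set w | _] = \bigcap_(i in [set: 'I_n.+1]) [set w | X i w = c i]).
  by apply: fin_bigcap_measurable => //; apply: finite_finset.
apply/seteqP; split=> w /= => [<- i _|wc]; first by rewrite /history ffunE.
by apply/ffunP => i; rewrite ffunE wc.
Qed.

(** The one-step rule for single trajectories is summed over the cylinders making up an event of the
    past that fixes the present state. *)
Lemma markov_property n (H : pred {ffun 'I_n.+1 -> V}) x y :
  (forall c, H c -> c ord_max = x) ->
  Pr ([set w | H (history n w)] `&` [set w | X n.+1 w = y]) =
  (Pr [set w | H (history n w)] * (P x y)%:E)%E.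
Proof.
move=> Hx; have [X_meas _ X_step] := X_chain.
have H_meas := measurable_finite_valued _ (measurable_history n) H.
rewrite (measure_fibers _ (measurable_history n)); last exact: measurableI.
rewrite (measure_fibers _ (measurable_history n) _ _ H_meas).
rewrite ge0_sume_distrl //; apply: eq_bigr => c _.
have [Hc|nHc] := boolP (H c); last first.
  have disj : [set w | H (history n w)] `&` [set w | history n w = c] = set0.
    by apply/seteqP; split=> // w /= [Hw wc]; move: nHc; rewrite -wc Hw.
  by rewrite setIAC disj set0I measure0 mul0e.
(* [markov_chain] speaks of infinite sequences of states, so the finite past [c] is continued by
   [y]. *)
pose path i := if (i <= n)%N then c (inord i) else y.
have path_n : path n = x.
  by rewrite /path leqnn -(Hx _ Hc); congr (c _); apply: val_inj; rewrite /= inordK.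
have path_Sn : path n.+1 = y by rewrite /path ltnn.
have past (w : Omega) : history n w = c <-> forall i, (i <= n)%N -> X i w = path i.
  have /seteqP[] := history_cylinder n c => hc ch; split=> [/hc /= wc i i_n|wc].
    by rewrite /path i_n wc.
  by apply: ch => i i_n /=; rewrite wc // /path i_n.
rewrite -path_Sn -path_n.
rewrite [X in (Pr X * _)%E](_ : _ = [set w | forall i, (i <= n)%N -> X i w = path i]).
  rewrite -X_step; congr (Pr _); apply/seteqP; split=> w /=.
    move=> [[_ wy] /past wc] i; rewrite leq_eqVlt => /orP[/eqP->//|].
    by rewrite ltnS; apply: wc.
  move=> wc; have hw : history n w = c by apply/past => i i_n; apply: wc; apply: leqW.
  by split=> //; split; rewrite ?hw //; apply: wc.
apply/seteqP; split=> w /=; first by move=> [_ /past].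
by move=> /past wc; split=> //; rewrite wc.
Qed.

Definition avoids n : set Omega := [set w | forall i, (i <= n)%N -> X i w \notin A].

(* The unnormalized law of [X n] on the event that [A] is not hit by time [n]. *)
Fixpoint killed_law n : V -> R :=
  if n is n'.+1 then fun y => (y \notin A)%:R * \sum_x killed_law n' x * P x y
  else fun x => (x \notin A)%:R * mu x.

Lemma killed_law_ge0 n x : 0 <= killed_law n x.
Proof.
elim: n x => [|n IHn] x /=; rewrite mulr_ge0 ?ler0n //.
  by case: mu_distr.
by apply: sumr_ge0 => y _; rewrite mulr_ge0 //; case: (Ptrans y).
Qed.

Lemma avoids_history n :
  avoids n = [set w | [forall i, history n w i \notin A]].
Proof.
apply/seteqP; split=> w /=.
  by move=> wA; apply/forallP => i; rewrite ffunE wA // -ltnS.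
by move=> /forallP wA i i_n; have := wA (inord i); rewrite ffunE inordK.
Qed.

Lemma measurable_avoids n : measurable (avoids n).
Proof.
rewrite avoids_history.
exact: (measurable_finite_valued _ (measurable_history n) (fun c => [forall i, c i \notin A])).
Qed.

(** For [x] outside [A], avoiding [A] up to [n.+1] and being at [x] then only requires avoidance up
    to [n]; splitting on the state at time [n] brings in the Markov property. *)
Lemma killed_lawE n x :
  Pr (avoids n `&` [set w | X n w = x]) = (killed_law n x)%:E.
Proof.
have [X_meas X_init X_step] := X_chain.
elim: n x => [|n IHn] x /=; have [xA|xA] := boolP (x \in A) => /=.
- rewrite mul0r (_ : _ `&` _ = set0) ?measure0 //; apply/seteqP; split=> // w /=.
  by move=> [/(_ 0%N isT) + wx]; rewrite wx xA.
- rewrite mul1r -X_init; congr (Pr _); apply/seteqP; split=> w /=.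
    by case.
  by move=> wx; split=> // i; rewrite leqn0 => /eqP->; rewrite wx.
- rewrite mul0r (_ : _ `&` _ = set0) ?measure0 //; apply/seteqP; split=> // w /=.
  by move=> [/(_ n.+1 (leqnn _)) + wx]; rewrite wx xA.
rewrite mul1r [X in Pr X](_ : _ = avoids n `&` [set w | X n.+1 w = x]); last first.
  apply/seteqP; split=> w /= [wA wx]; split=> // i; first by move=> i_n; apply/wA/leqW.
  by rewrite leq_eqVlt => /orP[/eqP->|]; [rewrite wx|apply: wA].
rewrite (measure_fibers _ (X_meas n)); last first.
  by apply: measurableI; [exact: measurable_avoids|exact: X_meas].
rewrite -sumEFin; apply: eq_bigr => y _; rewrite EFinM -IHn.
pose H (c : {ffun 'I_n.+1 -> V}) := [forall i, c i \notin A] && (c ord_max == y).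
have HE : avoids n `&` [set w | X n w = y] = [set w | H (history n w)].
  rewrite avoids_history; apply/seteqP; split=> w /=.
    by move=> [wA wy]; rewrite /H wA /= ffunE wy.
  by rewrite /H => /andP[-> /eqP <-] /=; rewrite ffunE.
by rewrite HE setIAC HE; apply: markov_property => c /andP[_ /eqP].
Qed.

(** Tail-sum formula: [avoids n] is the event that the hitting time exceeds [n]. It also covers
    trajectories that never hit [A], where both sides are infinite. *)
Lemma hitting_timeE w :
  hitting_time X A w = (\sum_(0 <= n <oo) (\1_(avoids n) w)%:E)%E :> \bar R.
Proof.
have ind_ge0 n : (0 <= (\1_(avoids n) w : R)%:E)%E by rewrite lee_fin.
have [[m mA]|never] := pselect (exists m, X m w \in A).
  have [k kA k_min] := ex_minnP (ex_intro (fun m => X m w \in A) m mA).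
  have -> : hitting_time X A w = k%:R%:E :> \bar R.
    apply/eqP; rewrite eq_le; apply/andP; split.
      by apply: ereal_inf_lbound; exists k.
    by apply: le_ereal_inf_tmp => _ [j /= jA <-]; rewrite lee_fin ler_nat k_min.
  rewrite (nneseries_split 0 k) // add0n [X in (_ + X)%E]eseries0 ?adde0.
    rewrite (eq_big_nat _ _ (F2 := fun=> 1%:E)).
      by rewrite sumEFin big_const_nat subn0 iter_addr addr0.
    move=> i /= i_k; rewrite indicE mem_set // => j j_i /=.
    by apply: contraTN i_k => jA; rewrite -leqNgt (leq_trans (k_min _ jA)).
  move=> i k_i _; rewrite indicE memNset //= => /(_ k k_i).
  by rewrite kA.
have -> : hitting_time X A w = +oo%E :> \bar R.
  rewrite /hitting_time [X in ereal_inf X](_ : _ = set0) ?ereal_inf0 //.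
  by apply/seteqP; split=> // _ [j /= jA _]; apply: never; exists j.
apply/esym/eqyP => r r_gt0.
have [k rk] : exists k : nat, r <= k%:R.
  by exists (Num.truncn r).+1; apply/ltW/Num.Theory.truncnS_gt.
apply: (le_trans _ (nneseries_lim_ge k (fun n _ _ => ind_ge0 n))).
rewrite (eq_bigr (fun=> 1%:E)).
  by rewrite sumEFin big_const_nat subn0 iter_addr addr0 lee_fin.
move=> i _; rewrite indicE mem_set // => j _.
by apply/negP => jA; apply: never; exists j.
Qed.

(** With [mass n] the probability of avoiding [A] up to time [n] and [rest n] the integral of
    [h (X n)] over that event, the system for [h] gives [rest n.+1 = rest n - mass n]. The sum of
    the [mass n] therefore telescopes. *)
Lemma integral_hitting_time (h : V -> R) : (forall x, 0 <= h x) ->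
  (forall x, x \in A -> h x = 0) ->
  (forall x, x \notin A -> h x = 1 + \sum_y P x y * h y) ->
  (\int[Pr]_w hitting_time X A w = (\sum_x mu x * h x)%:E)%E.
Proof.
move=> h_ge0 hA hB.
have P_ge0 x y : 0 <= P x y by case: (Ptrans x).
under eq_integral do rewrite hitting_timeE.
rewrite integral_nneseries //; last first.
  by move=> n; apply/measurable_EFinP/measurable_indic; exact: measurable_avoids.
pose mass n := \sum_x killed_law n x.
pose rest n := \sum_x killed_law n x * h x.
have killedA n x : x \in A -> killed_law n x = 0.
  by case: n => [|n] xA /=; rewrite xA mul0r.
have mass_ge0 n : 0 <= mass n by apply: sumr_ge0 => x _; apply: killed_law_ge0.
have rest_ge0 n : 0 <= rest n.
  by apply: sumr_ge0 => x _; rewrite mulr_ge0 ?killed_law_ge0.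
have massE n : (\int[Pr]_w (\1_(avoids n) w)%:E = (mass n)%:E)%E.
  rewrite integral_indic //; last exact: measurable_avoids.
  rewrite setIT /mass -sumEFin; under eq_bigr do rewrite -killed_lawE.
  have [X_meas _ _] := X_chain.
  by apply: (measure_fibers _ (X_meas n)); exact: measurable_avoids.
have step n : rest n.+1 = rest n - mass n.
  rewrite /rest /mass -sumrB /=.
  transitivity (\sum_x killed_law n x * \sum_y P x y * h y).
    transitivity (\sum_y \sum_x killed_law n x * P x y * h y).
      apply: eq_bigr => y _; rewrite -mulr_suml; have [yA|yA] := boolP (y \in A).
        by rewrite hA // !mulr0.
      by rewrite mul1r.
    rewrite exchange_big /=; apply: eq_bigr => x _; rewrite mulr_sumr.
    by apply: eq_bigr => y _; rewrite mulrA.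
  apply: eq_bigr => x _; have [xA|xA] := boolP (x \in A).
    by rewrite killedA // !mul0r subr0.
  by rewrite hB // mulrDr mulr1 addrAC subrr add0r.
have rest0 : rest 0%N = \sum_x mu x * h x.
  apply: eq_bigr => x _ /=; have [xA|xA] := boolP (x \in A).
    by rewrite hA // !mulr0.
  by rewrite mul1r.
have partial N : series mass N = rest 0%N - rest N.
  rewrite /series /=; elim: N => [|N IHN]; first by rewrite big_geq // subrr.
  by rewrite big_nat_recr //= IHN step; ring.
have mass_cvg : cvgn (series mass).
  apply: nondecreasing_is_cvgn.
    apply/nondecreasing_seqP => n; rewrite /series /= big_nat_recr //= lerDl.
    exact: mass_ge0.
  by exists (rest 0%N) => _ [n _ <-]; rewrite partial gerBl.
(* The partial sums of [mass] are bounded by [rest 0], so [mass] tends to 0, and it dominates [rest]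
   up to the constant [\sum_x h x]. *)
have rest_cvg : (rest n @[n --> \oo] --> 0)%classic.
  have bound n : 0 <= rest n <= (\sum_x h x) * mass n.
    rewrite rest_ge0 /= mulr_sumr; apply: ler_sum => x _; rewrite mulrC.
    rewrite ler_wpM2r ?killed_law_ge0 // (bigD1 x) //= lerDl.
    by apply: sumr_ge0.
  apply: (squeeze_cvgr (f := fun=> 0) (h := fun n => (\sum_x h x) * mass n)).
  - by apply: nearW => n; apply: bound.
  - exact: cvg_cst.
  - rewrite -[X in _ --> X](mulr0 (\sum_x h x)).
    by apply: cvgM; [exact: cvg_cst|exact: cvg_series_cvg_0].
rewrite (eq_eseriesr (g := fun n => (mass n)%:E)) //.
have lim_mass : (series mass n @[n --> \oo] --> rest 0%N)%classic.
  rewrite (_ : series mass = fun n => rest 0%N - rest n); last exact/funext.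
  by rewrite -[X in _ --> X]subr0; apply: cvgB => //; exact: cvg_cst.
rewrite -rest0; apply/cvg_lim => //.
rewrite (_ : (fun n => _) = EFin \o series mass); last first.
  by apply/funext => n /=; rewrite sumEFin.
by apply: cvg_EFin; [exact: nearW|exact: lim_mass].
Qed.
End HittingTime.

(** * Comparison of hitting and relaxation times *)

Theorem theorem1p1 (R : realType) :
  exists c1 : R, 0 < c1 /\
    forall (V : finType) (P : V -> V -> R) (pi : V -> R),
      (2 <= #|V|)%N ->
      transition_matrix P ->
      irreducible P ->
      stationary P pi ->
      reversible P pi ->
      forall (d : measure_display) (Omega : measurableType d)
             (Pr : (V -> R) -> probability Omega R) (X : nat -> Omega -> V),
        (forall mu : V -> R, is_distr mu -> markov_chain P mu (Pr mu) X) ->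
        ((c1 * trel P)%:E <= tH pi Pr X)%E /\
        (tH pi Pr X <= (2 * trel P)%:E)%E.
Proof.
(* The inverse of the constant in [mean_hitting_ge]. *)
exists 6^-1; split; first by rewrite invr_gt0 ltr0n.
move=> V P pi V2 Ptrans Pirr Pstat Prev d Omega Pr X X_chain.
have [b1 [f [f_neq0 f_mean fE]] gap] := spectral_gap P pi Ptrans Pirr Pstat Prev V2.
have gap_gt0 : 0 < 1 - beta2 P by rewrite subr_gt0.
have half_gt0 : 0 < 2^-1 :> R by rewrite invr_gt0 ltr0n.
have expected (A : {set V}) : A \proper [set: V]%SET -> 2^-1 <= prob_of pi A ->
    exists h, [/\ hitting_solution P A h, 0 < prob_of pi (~: A)%SET &
      expected_hitting Pr X (conditioned pi (~: A)%SET) A =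
      (mean pi h / prob_of pi (~: A)%SET)%:E].
  move=> Aproper A_half.
  have A_neq0 : A != finset.set0.
    apply: contraTneq A_half => ->; rewrite /prob_of big_set0 -ltNge //.
  have B_gt0 : 0 < prob_of pi (~: A)%SET.
    apply: prob_gt0 Ptrans Pirr Pstat _ _.
    have [_ [x _ xA]] := properP Aproper.
    by apply/set0Pn; exists x; rewrite finset.in_setC.
  have [h sol] := hitting_solution_exists P pi Ptrans Pirr Pstat Prev A A_neq0.
  have [h_ge0 hA hB] := sol; exists h; split=> //.
  have distr := conditioned_is_distr _ _ pi (~: A)%SET (fun x => stationary_ge0 P pi Pstat x) B_gt0.
  rewrite /expected_hitting.
  rewrite (integral_hitting_time P _ _ _ _ Ptrans distr (X_chain _ distr) h h_ge0 hA hB).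
  congr (_%:E); rewrite /mean mulr_suml; apply: eq_bigr => x _.
  rewrite /conditioned finset.in_setC; have [xA|xA] /= := boolP (x \in A).
    by rewrite hA // !mulr0 mul0r.
  by rewrite mulrAC.
split.
  have [A [Aproper A_half Ah]] :=
    mean_hitting_ge P pi Ptrans Pirr Pstat Prev _ f b1 fE f_mean f_neq0.
  have [h [sol B_gt0 hE]] := expected A Aproper A_half.
  rewrite /tH; apply: le_trans (le_bigmax_cond _ _ (j := A) _); last exact/andP.
  rewrite hE lee_fin ler_pdivlMr // /trel.
  by rewrite -invfM ler_pdivrMl ?mulr_gt0 ?ltr0n //; apply: Ah.
apply: bigmax_le => [|A /andP[Aproper A_half]]; first exact: leNye.
have [h [sol B_gt0 ->]] := expected A Aproper A_half.
rewrite lee_fin ler_pdivrMr // /trel.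
have hit := mean_hitting_le P pi Ptrans Pirr Pstat _ A h b1 gap Aproper sol.
have m_ge0 : 0 <= mean pi h.
  have [h_ge0 _ _] := sol; apply: sumr_ge0 => x _.
  by rewrite mulr_ge0 ?(stationary_ge0 P pi Pstat).
have gm_ge0 : 0 <= (1 - beta2 P) * mean pi h by rewrite mulr_ge0 // ltW.
(* The condition [pi(A) >= 1/2] enters here and yields the factor 2 of the upper bound. *)
have half_hit : (1 - beta2 P) * mean pi h * 2^-1 <= prob_of pi (~: A)%SET.
  by apply: le_trans hit; rewrite [leRHS]mulrAC ler_wpM2l.
rewrite -(ler_pM2l gap_gt0) [leRHS](_ : _ = 2 * prob_of pi (~: A)%SET); first lra.
by field; rewrite gt_eqF.
Qed.
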